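(* Let $d\ge 1$, let $\widehat{F}_d$ be the free profinite group on $d$ generators, let $H$ be a finite group and let $\pi:\widehat{F}_d\to H$ be a continuous epimorphism with kernel $R$. Let $\overline{R}=R/[R,R]$, let $A(\pi)=\{\alpha\in\mathrm{Aut}(\widehat{F}_d):\pi\circ\alpha=\pi\}$, and let $\rho:A(\pi)\to\mathrm{GL}(\overline{R})$ be the homomorphism given by the induced action of $A(\pi)$ on $\overline{R}$. Let $\beta\in H^2(H,\overline{R})$ be the extension class of the short exact sequence $$1\to\overline{R}\to\widehat{F}_d/[R,R]\xrightarrow{\overline{\pi}}H\to 1,$$ where $\overline{\pi}$ is induced by $\pi$. Then the image $\rho(A(\pi))$ equals the group $\mathrm{Aut}_{H,\beta}(\overline{R})$ of all $\widehat{\mathbb{Z}}[H]$-module automorphisms $\gamma$ of $\overline{R}$ that preserve $\beta$, i.e. such that $\gamma_*(\beta)=\beta$ in $H^2(H,\overline{R})$.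
   Context: $[R,R]$ is the closed commutator subgroup, so $\overline{R}$ is the maximal abelian profinite quotient of $R$; it is a $\widehat{\mathbb{Z}}[H]$-module via the conjugation action of $\widehat{F}_d/[R,R]$. Automorphisms of profinite groups are continuous. For $\gamma$ an $H$-module automorphism of $\overline{R}$, $\gamma_*$ denotes the induced automorphism of $H^2(H,\overline{R})$. *)

(* Defs.v *)
From HB Require Import structures.
From mathcomp Require Import fingroup.
From mathcomp Require Import all_boot all_order all_algebra.
From mathcomp Require Import all_classical.
From mathcomp Require Import topology tvs.

Set Implicit Arguments.
Unset Strict Implicit.
Unset Printing Implicit Defensive.

Import GRing.Theory.

Local Open Scope classical_set_scope.
Local Open Scope group_scope.
Local Open Scope quotient_scope.

HB.mixin Record Group_isTopological G of monoid.Group G & Topological G := {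
  mulg_continuous : continuous (fun x : G * G => x.1 * x.2);
  invg_continuous : continuous (fun x : G => x^-1)
}.

#[short(type="topGroupType")]
HB.structure Definition TopGroup :=
  {G of Group_isTopological G & monoid.Group G & Topological G}.

HB.mixin Record TopGroup_isProfinite G of TopGroup G := {
  profinite_compact : compact [set: G];
  profinite_hausdorff : hausdorff_space G;
  profinite_totally_disconnected : totally_disconnected [set: G]
}.

#[short(type="profiniteGroupType")]
HB.structure Definition ProfiniteGroup :=
  {G of TopGroup_isProfinite G & TopGroup G}.

(* universal property of the free profinite group on the d generators x *)
Definition free_profinite (d : nat) (F : profiniteGroupType) (x : 'I_d -> F) :=
  forall (K : profiniteGroupType) (g : 'I_d -> K),
    exists! f : F -> K,
      [/\ {morph f : a b / a * b}, continuous f & forall i, f (x i) = g i].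

Definition is_subgroup (G : groupType) (A : set G) :=
  [/\ A 1, forall a b, A a -> A b -> A (a * b) & forall a, A a -> A a^-1].

Record normalSubgroup (G : groupType) := NormalSubgroup {
  nsub_set :> set G;
  nsub_subgroup : is_subgroup nsub_set;
  nsub_conj : forall a g, nsub_set a -> nsub_set (a ^ g)
}.

Section Quotient.
Variables (G : topGroupType) (N : normalSubgroup G).

Definition coset_rel : rel G := fun a b => `[< nsub_set N (a^-1 * b) >].

Lemma coset_rel_equiv : equiv_class_of coset_rel.
Proof.
have [N1 NM NV] := nsub_subgroup N; split=> [a|a b|b a c].
- by apply/asboolP; rewrite mulVg.
- by apply/asboolP/asboolP => /NV; rewrite invgM invgK.
- move=> /asboolP Nab /asboolP Nbc; apply/asboolP.
  by have := NM _ _ Nab Nbc; rewrite mulgA mulgK.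
Qed.

Canonical coset_rel_equivRel := EquivRelPack coset_rel_equiv.
Canonical coset_rel_encModRel := defaultEncModRel coset_rel.

Definition quotg := quotient_topology {eq_quot coset_rel}.
HB.instance Definition _ := Topological.on quotg.
HB.instance Definition _ := Quotient.on quotg.

Definition coset_map (a : G) : quotg := \pi_quotg a.

Lemma coset_mapP a b : coset_map a = coset_map b <-> nsub_set N (a^-1 * b).
Proof.
split=> [eq_ab|Nab]; last by apply/eqmodP/asboolP.
apply/asboolP; change (is_true (coset_rel a b)).
exact: (introT (@eqmodP _ coset_rel_equivRel a b)).
Qed.

Lemma repr_coset_map a : nsub_set N (a^-1 * repr (coset_map a)).
Proof. by apply/coset_mapP; rewrite /coset_map reprK. Qed.

Lemma coset_map_repr (u : quotg) : coset_map (repr u) = u.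
Proof. exact: reprK. Qed.

Definition quotg_one : quotg := coset_map 1.
Definition quotg_mul (u v : quotg) : quotg := coset_map (repr u * repr v).
Definition quotg_inv (u : quotg) : quotg := coset_map (repr u)^-1.

Lemma nsubJV a g : nsub_set N a -> nsub_set N (g * a * g^-1).
Proof. by move=> /(@nsub_conj _ N _ g^-1); rewrite conjgE invgK mulgA. Qed.

Lemma coset_map_mul a b :
  quotg_mul (coset_map a) (coset_map b) = coset_map (a * b).
Proof.
apply/esym/coset_mapP; have [_ NM _] := nsub_subgroup N.
have Na := repr_coset_map a; have Nb := repr_coset_map b.
have := NM _ _ (nsub_conj b Na) Nb.
by rewrite conjgE invgM -!mulgA mulKVg.
Qed.

Lemma coset_map_inv a : quotg_inv (coset_map a) = coset_map a^-1.
Proof.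
apply/esym/coset_mapP; have [_ _ NV] := nsub_subgroup N.
have /NV/(@nsubJV _ a) := repr_coset_map a.
by rewrite invgM invgK -!mulgA mulgV mulg1.
Qed.

Let quotg_ind (P : quotg -> Prop) : (forall a, P (coset_map a)) -> forall u, P u.
Proof. by move=> PP u; rewrite -[u]coset_map_repr. Qed.

Lemma quotg_mulA : associative quotg_mul.
Proof.
elim/quotg_ind=> a; elim/quotg_ind=> b; elim/quotg_ind=> c.
by rewrite !coset_map_mul mulgA.
Qed.
Lemma quotg_mul1 : left_id quotg_one quotg_mul.
Proof. by elim/quotg_ind=> a; rewrite coset_map_mul mul1g. Qed.
Lemma quotg_mulr1 : right_id quotg_one quotg_mul.
Proof. by elim/quotg_ind=> a; rewrite coset_map_mul mulg1. Qed.
Lemma quotg_mulV : left_inverse quotg_one quotg_inv quotg_mul.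
Proof. by elim/quotg_ind=> a; rewrite coset_map_inv coset_map_mul mulVg. Qed.
Lemma quotg_mulrV : right_inverse quotg_one quotg_inv quotg_mul.
Proof. by elim/quotg_ind=> a; rewrite coset_map_inv coset_map_mul mulgV. Qed.

HB.instance Definition _ := isGroup.Build quotg
  quotg_mulA quotg_mul1 quotg_mulr1 quotg_mulV quotg_mulrV.

Lemma coset_mapM : {morph coset_map : a b / a * b}.
Proof. by move=> a b; rewrite [RHS]coset_map_mul. Qed.
Lemma coset_map1 : coset_map 1 = 1. Proof. by []. Qed.
Lemma coset_mapV : {morph coset_map : a / a^-1}.
Proof. by move=> a; rewrite [RHS]coset_map_inv. Qed.

Lemma coset_map_continuous : continuous coset_map.
Proof. exact: pi_continuous. Qed.

Lemma coset_map_open (U : set G) : open U -> open (coset_map @` U).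
Proof.
move=> oU; suff -> : coset_map @` U =
    ([set u | exists n, nsub_set N n /\ U (repr u * n)] : set quotg).
  rewrite /open /= /quotient_open.
  suff -> : \pi_quotg @^-1` [set u | exists n, nsub_set N n /\ U (repr u * n)] =
    \bigcup_(n in N) ((fun a => a * n) @^-1` U).
    apply: bigcup_open => n _; move: U oU; apply/continuousP => x.
    apply: (@continuous_comp _ _ _ (fun x => (x, n)) (fun x : G * G => x.1 * x.2)).
      by apply: cvg_pair => /=; [exact: cvg_id|exact: cvg_cst].
    exact: mulg_continuous.
  apply/seteqP; split=> a /=.
    move=> [n [Nn Un]]; exists (a^-1 * repr (coset_map a) * n).
      by have [_ NM _] := nsub_subgroup N; apply: NM => //; exact: repr_coset_map.
    by rewrite /= -!mulgA mulKVg.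
  move=> [n Nn /= Un]; exists ((repr (coset_map a))^-1 * a * n); split.
    have [_ NM NV] := nsub_subgroup N; apply: NM => //.
    by rewrite -[(_ * _)]invgK invgM invgK; apply/NV/repr_coset_map.
  by rewrite -!mulgA mulKVg.
apply/seteqP; split=> [_ [a Ua <-] /=|u /= [n [Nn Un]]].
  exists ((repr (coset_map a))^-1 * a); rewrite mulKVg; split => //.
  have [_ NM NV] := nsub_subgroup N.
  by rewrite -[(_ * _)]invgK invgM invgK; apply/NV/repr_coset_map.
exists (repr u * n) => //; rewrite -[RHS]coset_map_repr; apply/coset_mapP.
have [_ NM NV] := nsub_subgroup N.
by rewrite invgM mulgVK; exact: NV.
Qed.

Lemma quotg_mul_continuous : continuous (fun x : quotg * quotg => x.1 * x.2).
Proof.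
move=> [u v]; rewrite -[u]coset_map_repr -[v]coset_map_repr.
move: (repr u) (repr v) => a b W /=.
rewrite -coset_mapM => /coset_map_continuous Wab.
have [[A B] /= [nA nB] AB] := @mulg_continuous G (a, b) _ Wab.
rewrite /= nbhsE in nA; rewrite /= nbhsE in nB.
move: nA nB => [A' [oA' A'a] A'A] [B' [oB' B'b] B'B].
exists (coset_map @` A', coset_map @` B') => /=.
  split; apply: open_nbhs_nbhs; split; [| by exists a| | by exists b];
    exact: coset_map_open.
move=> [_ _] /= [[x A'x <-] [y B'y <-]]; rewrite -coset_mapM.
by apply: (AB (x, y)); split; [exact: A'A|exact: B'B].
Qed.

Lemma quotg_inv_continuous : continuous (fun x : quotg => x^-1).
Proof.
apply/continuousP => W oW; rewrite /open /= /quotient_open.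
rewrite (_ : _ @^-1` _ = (coset_map \o (fun x : G => x^-1)) @^-1` W); last first.
  by apply/funext => a; congr W; exact/esym/coset_mapV.
by apply: open_comp => // x _; apply: continuous_comp;
  [exact: invg_continuous|exact: coset_map_continuous].
Qed.

HB.instance Definition _ := Group_isTopological.Build quotg
  quotg_mul_continuous quotg_inv_continuous.
End Quotient.

Section ClosedCommutator.
Variable G : topGroupType.
Implicit Types (A : set G) (R : normalSubgroup G).

Lemma closure_subgroup A : is_subgroup A -> is_subgroup (closure A).
Proof.
move=> [A1 AM AV]; split=> [|a b Aa Ab W|a Aa W]; first exact: subset_closure.
  move=> /(@mulg_continuous G (a, b)) [[U V] /= [/Aa [x [Ax Ux]] /Ab [y [Ay Vy]]] UV].
  by exists (x * y); split; [exact: AM|exact: (UV (x, y))].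
move=> /(@invg_continuous G a)/Aa [x [Ax Wx]].
by exists x^-1; split; [exact: AV|].
Qed.

Lemma mulg_continuous_lr (x y : G) : continuous (fun a : G => x * a * y).
Proof.
move=> a; apply: (@continuous_comp _ _ _ (fun a => (x * a, y))
  (fun x : G * G => x.1 * x.2)); last exact: mulg_continuous.
apply: cvg_pair; last exact: cvg_cst.
apply: (@continuous_comp _ _ _ (fun a => (x, a)) (fun x : G * G => x.1 * x.2)).
  by apply: cvg_pair; [exact: cvg_cst|exact: cvg_id].
exact: mulg_continuous.
Qed.

Lemma conjg_continuous (g : G) : continuous (fun a : G => a ^ g).
Proof.
rewrite (_ : (fun _ => _) = fun a : G => g^-1 * a * g).
  exact: mulg_continuous_lr.
by apply/funext => a; rewrite conjgE mulgA.
Qed.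

Lemma closure_conj A (g : G) : (forall a, A a -> A (a ^ g)) ->
  forall a, closure A a -> closure A (a ^ g).
Proof.
move=> AJ a Aa W /(@conjg_continuous g a)/Aa [x [Ax Wx]].
by exists (x ^ g); split; [exact: AJ|].
Qed.

Definition commutator_set R : set G :=
  [set c | exists r s, [/\ nsub_set R r, nsub_set R s & c = [~ r, s]]].

(* closure of the abstract subgroup generated by the commutators *)
Definition closed_commutator_set R : set G :=
  closure (smallest (@is_subgroup G) (commutator_set R)).

Lemma smallest_subgroup A : is_subgroup (smallest (@is_subgroup G) A).
Proof.
split=> [B [[]] //|a b Sa Sb B /[dup] -[[_ BM _] _] SB|a Sa B /[dup] -[[_ _ BV] _] SB].
  by apply: BM; [exact: Sa|exact: Sb].
by apply: BV; exact: Sa.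
Qed.

Lemma smallest_subgroup_conj A (g : G) : (forall a, A a -> A (a ^ g)) ->
  forall a, smallest (@is_subgroup G) A a -> smallest (@is_subgroup G) A (a ^ g).
Proof.
move=> AJ a Sa.
apply: (Sa [set b | smallest (@is_subgroup G) A (b ^ g)]); split; last first.
  by move=> b Ab; apply: sub_gen_smallest; exact: AJ.
have [S1 SM SV] := smallest_subgroup A.
split; first by rewrite /= conj1g.
- by move=> b c Sb Sc; rewrite /= conjMg; exact: SM.
- by move=> b Sb; rewrite /= conjVg; exact: SV.
Qed.

Lemma closed_commutator_subgroup R : is_subgroup (closed_commutator_set R).
Proof. exact/closure_subgroup/smallest_subgroup. Qed.

Lemma closed_commutator_conj R (a g : G) :
  closed_commutator_set R a -> closed_commutator_set R (a ^ g).
Proof.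
apply: closure_conj => {}a; apply: smallest_subgroup_conj => _ [r [s [Rr Rs ->]]].
exists (r ^ g), (s ^ g); split; [exact: nsub_conj|exact: nsub_conj|].
by rewrite conjRg.
Qed.

Definition closed_commutator R : normalSubgroup G :=
  NormalSubgroup (closed_commutator_subgroup R) (@closed_commutator_conj R).

Lemma closed_commutatorR R r s : nsub_set R r -> nsub_set R s ->
  nsub_set (closed_commutator R) [~ r, s].
Proof.
move=> Rr Rs; apply: subset_closure; apply: sub_gen_smallest.
by exists r, s.
Qed.

Lemma closed_commutator_sub R : closed (nsub_set R) ->
  nsub_set (closed_commutator R) `<=` nsub_set R.
Proof.
have [R1 RM RV] := nsub_subgroup R.
move=> /closure_id cR; rewrite [X in _ `<=` X]cR; apply: closureS.
apply: smallest_sub; first exact: nsub_subgroup.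
move=> _ [r [s [Rr Rs ->]]]; rewrite commgEl; apply: RM; first exact: RV.
exact: nsub_conj.
Qed.
End ClosedCommutator.

(* the finite group H carries the discrete topology *)
Record contEpi (F : topGroupType) (H : finGroupType) := ContEpi {
  epi_fun :> F -> H;
  epiM : {morph epi_fun : a b / a * b};
  epi_continuous : continuous (epi_fun : F -> discrete_topology H);
  epi_surj : forall h, exists a, epi_fun a = h
}.

HB.mixin Record isGModule (G : groupType) A of GRing.Zmodule A := {
  gact : G -> A -> A;
  gactD : forall g, {morph gact g : a b / (a + b)%R};
  gact1 : gact 1 =1 id;
  gactM : forall g h a, gact (g * h) a = gact g (gact h a)
}.

#[short(type="gmodType")]
HB.structure Definition GModule (G : groupType) :=
  {A of isGModule G A & GRing.Zmodule A}.

#[short(type="topGModType")]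
HB.structure Definition TopGModule (G : groupType) :=
  {A of GModule G A & TopologicalZmodule A & Pointed A}.

(* Inhomogeneous cochains; for finite discrete G every cochain is continuous,
   so H2 G A is also the continuous cohomology group. *)
Section Cohomology.
Local Open Scope ring_scope.
Variables (G : groupType) (A : gmodType G).

Lemma gact0 g : gact g 0 = 0 :> A.
Proof. by apply: (addIr (gact g 0)); rewrite -gactD !add0r. Qed.

Lemma gactN g : {morph gact g : a / - a >-> - a : A}.
Proof. by move=> a; apply: (addrI (gact g a)); rewrite -gactD !subrr gact0. Qed.

Definition is_cocycle2 (f : G -> G -> A) := forall g h k : G,
  gact g (f h k) - f (g * h)%g k + f g (h * k)%g - f g h = 0.

Definition coboundary1 (c : G -> A) : G -> G -> A :=
  fun g h => gact g (c h) - c (g * h)%g + c g.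

Definition cocycle2_pred : {pred G -> G -> A} := fun f => `[< is_cocycle2 f >].

Lemma cocycle2_zmod_closed : zmod_closed cocycle2_pred.
Proof.
split=> [|f f' /asboolP Zf /asboolP Zf']; apply/asboolP => g h k.
  by rewrite -[LHS]/(gact g 0 - 0 + 0 - 0) gact0 !subr0 addr0.
rewrite -[LHS]/(gact g (f h k - f' h k) - (f (g * h)%g k - f' (g * h)%g k) +
  (f g (h * k)%g - f' g (h * k)%g) - (f g h - f' g h)).
rewrite gactD gactN opprD [X in X + _ - _]addrACA -opprD.
by rewrite [X in X - _]addrACA -opprD [- (_ - f' _ _)]opprD addrACA -opprD Zf Zf' subrr.
Qed.

HB.instance Definition _ :=
  GRing.isZmodClosed.Build (G -> G -> A) cocycle2_pred cocycle2_zmod_closed.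

Definition Z2 := {f : G -> G -> A | f \in cocycle2_pred}.
HB.instance Definition _ := SubChoice.on Z2.
HB.instance Definition _ := [SubChoice_isSubZmodule of Z2 by <:].

Lemma Z2P (f : Z2) : is_cocycle2 (val f).
Proof. by have /asboolP := valP f. Qed.

Definition mkZ2 (f : G -> G -> A) (Zf : is_cocycle2 f) : Z2 :=
  exist (fun f => f \in cocycle2_pred) f (asboolT Zf).

Definition B2 : {pred Z2} := fun f => `[< exists c, val f = coboundary1 c >].

Lemma B2_zmod_closed : zmod_closed B2.
Proof.
split=> [|f f' /asboolP[c fE] /asboolP[c' f'E]]; apply/asboolP.
  by exists 0; apply/funext => g; apply/funext => h;
    rewrite -[RHS]/(gact g 0 - 0 + 0) gact0 subr0 addr0.
exists (c - c'); rewrite raddfB /= fE f'E; apply/funext => g; apply/funext => h.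
rewrite -[LHS]/(coboundary1 c g h - coboundary1 c' g h) /coboundary1.
rewrite -[RHS]/(gact g (c h - c' h) - (c (g * h)%g - c' (g * h)%g) + (c g - c' g)).
by rewrite gactD gactN [- (_ - c' _)]opprD [X in _ = X + _]addrACA -opprD
  [RHS]addrACA -opprD.
Qed.

HB.instance Definition _ := GRing.isZmodClosed.Build Z2 B2 B2_zmod_closed.

Definition H2 := Quotient.quot B2.
HB.instance Definition _ := GRing.Zmodule.on H2.

Definition H2_class (f : Z2) : H2 := \pi_H2 f.
End Cohomology.

Record gmodHom (G : groupType) (A B : gmodType G) := GModHom {
  gmodHom_fun :> A -> B;
  gmodHomD : {morph gmodHom_fun : a b / (a + b)%R};
  gmodHom_act : forall g a, gmodHom_fun (gact g a) = gact g (gmodHom_fun a)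
}.

Section Functoriality.
Local Open Scope ring_scope.
Variables (G : groupType) (A B : gmodType G) (u : gmodHom A B).

Lemma gmodHom0 : u 0 = 0.
Proof. by apply: (addIr (u 0)); rewrite -gmodHomD !add0r. Qed.

Lemma gmodHomN : {morph u : a / - a}.
Proof. by move=> a; apply: (addrI (u a)); rewrite -gmodHomD !subrr gmodHom0. Qed.

Lemma Z2_map_subproof (f : Z2 A) : is_cocycle2 (fun g h => u (val f g h)).
Proof.
by move=> g h k; rewrite -gmodHom_act -!gmodHomN -!gmodHomD Z2P gmodHom0.
Qed.

Definition Z2_map (f : Z2 A) : Z2 B := mkZ2 (Z2_map_subproof f).

Definition H2_map (x : H2 A) : H2 B := H2_class (Z2_map (generic_quotient.repr x)).

Lemma H2_mapE (f : Z2 A) : H2_map (H2_class f) = H2_class (Z2_map f).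
Proof.
apply/eqP; rewrite -Quotient.idealrBE.
have /eqP : generic_quotient.repr (H2_class f) = f %[mod H2 A] by rewrite reprK.
rewrite -Quotient.idealrBE => /asboolP [c cE]; apply/asboolP.
exists (u \o c); apply/funext => g; apply/funext => h.
rewrite raddfB /coboundary1 /= -gmodHom_act -[LHS]/(u _ - u _).
by rewrite -!gmodHomN -!gmodHomD -[in RHS]/(coboundary1 c g h) -cE raddfB.
Qed.
End Functoriality.

(* The ring of profinite integers as the inverse limit of the Z/(n+1): component
   n is the residue modulo n+1. *)
Record zhat := Zhat {
  zhat_res :> forall n, 'I_n.+1;
  zhat_compat : forall m n, m.+1 %| n.+1 -> zhat_res n %% m.+1 = zhat_res m
}.

(* On a profinite abelian group, z acts as the limit of its integer
   approximations z mod n!. *)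
Definition zhat_scale (G : groupType) (A : topGModType G) (z : zhat) (a : A) : A :=
  lim ((fun n : nat => (a *+ z (n`!).-1)%R) @ \oo).

(* Automorphisms of A as a topological module over the completed group ring of
   G: G-equivariant, linear over the profinite integers, and continuous. *)
Record zhatGAut (G : groupType) (A : topGModType G) := ZhatGAut {
  zhatGAut_hom :> gmodHom A A;
  zhatGAut_scale : forall z a,
    zhatGAut_hom (zhat_scale z a) = zhat_scale z (zhatGAut_hom a);
  zhatGAut_bij : bijective zhatGAut_hom;
  zhatGAut_continuous : continuous zhatGAut_hom
}.

(* the underlying maps of the module automorphisms that fix the class b *)
Definition Aut_fixing (G : groupType) (A : topGModType G) (b : H2 A) :
    set (A -> A) :=
  [set u : A -> A | exists g : zhatGAut A, u = g /\ H2_map g b = b].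

Section Relation_module.
Variables (F : topGroupType) (H : finGroupType) (p : contEpi F H).

Lemma epi1 : p 1 = 1.
Proof. by apply: (mulgI (p 1)); rewrite -epiM !mulg1. Qed.

Lemma epiV : {morph p : a / a^-1}.
Proof. by move=> a; apply: (mulgI (p a)); rewrite -epiM !mulgV epi1. Qed.

Lemma ker_subgroup : is_subgroup [set a | p a = 1].
Proof.
split=> /= [|a b pa pb|a pa]; first exact: epi1.
  by rewrite epiM pa pb mulg1.
by rewrite epiV pa invg1.
Qed.

Lemma ker_conj (a g : F) : p a = 1 -> p (a ^ g) = 1.
Proof. by move=> pa; rewrite conjgE !epiM pa mul1g -epiM mulVg epi1. Qed.

Definition kerR : normalSubgroup F := NormalSubgroup ker_subgroup ker_conj.

Lemma kerR_closed : closed (nsub_set kerR).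
Proof.
rewrite (_ : nsub_set kerR = (p : F -> discrete_topology H) @^-1` [set 1]) //.
apply: closed_comp => [? _|]; first exact: epi_continuous.
exact: discrete_closed.
Qed.

(* F/[R,R] with the quotient topology, where R = ker p *)
Definition Fbar := quotg (closed_commutator kerR).
HB.instance Definition _ := TopGroup.on Fbar.
HB.instance Definition _ := Quotient.on Fbar.

Definition toFbar (a : F) : Fbar := coset_map (closed_commutator kerR) a.

Definition pbar (x : Fbar) : H := p (generic_quotient.repr x).

Lemma commR_ker a : nsub_set (closed_commutator kerR) a -> p a = 1.
Proof. by apply: closed_commutator_sub; exact: kerR_closed. Qed.

Lemma pbarE a : pbar (toFbar a) = p a.
Proof.
have /commR_ker := repr_coset_map (closed_commutator kerR) a.
by rewrite epiM epiV => /(canRL (mulKVg _)); rewrite mulg1.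
Qed.

Lemma pbarM : {morph pbar : x y / x * y}.
Proof.
move=> x y; rewrite -[x]coset_map_repr -[y]coset_map_repr -coset_mapM.
by rewrite !pbarE epiM.
Qed.

(* R/[R,R], as the image of R in F/[R,R] with the subspace topology. As R is
   open, this is the quotient topology of R/[R,R]. Written additively. *)
Definition Rbar_set : set Fbar := toFbar @` nsub_set kerR.

Lemma Rbar_setP (x : Fbar) : Rbar_set x <-> pbar x = 1.
Proof.
split=> [[a pa <-]|px]; first by rewrite pbarE.
by exists (generic_quotient.repr x) => //; exact: coset_map_repr.
Qed.

Definition Rbar := set_type Rbar_set.
HB.instance Definition _ := Topological.on Rbar.
HB.instance Definition _ := SubChoice.on Rbar.

Definition mkRbar (x : Fbar) (px : pbar x = 1) : Rbar :=
  exist (fun x => x \in Rbar_set) x (mem_set ((Rbar_setP x).2 px)).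

Lemma pbar1 : pbar 1 = 1.
Proof. by rewrite -[1]/(toFbar 1) pbarE epi1. Qed.

Lemma pbarV : {morph pbar : x / x^-1}.
Proof. by move=> x; apply: (mulgI (pbar x)); rewrite -pbarM !mulgV pbar1. Qed.

Lemma RbarP (x : Rbar) : pbar (val x) = 1.
Proof. by apply/Rbar_setP/set_mem; exact: valP x. Qed.

Lemma Rbar_comm (x y : Fbar) : pbar x = 1 -> pbar y = 1 -> x * y = y * x.
Proof.
move=> /Rbar_setP [a pa <-] /Rbar_setP [b pb <-].
rewrite -!coset_mapM; apply/esym/coset_mapP.
have := closed_commutatorR pa pb.
by rewrite commgEl conjgE invgM !mulgA.
Qed.

Lemma Rbar_mul_subproof (x y : Rbar) : pbar (val x * val y) = 1.
Proof. by rewrite pbarM !RbarP mulg1. Qed.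
Lemma Rbar_inv_subproof (x : Rbar) : pbar (val x)^-1 = 1.
Proof. by rewrite pbarV RbarP invg1. Qed.

Definition Rbar_add (x y : Rbar) : Rbar := mkRbar (Rbar_mul_subproof x y).
Definition Rbar_opp (x : Rbar) : Rbar := mkRbar (Rbar_inv_subproof x).
Definition Rbar_zero : Rbar := mkRbar pbar1.

Lemma Rbar_addA : associative Rbar_add.
Proof. by move=> x y z; apply: val_inj; rewrite /= mulgA. Qed.
Lemma Rbar_addC : commutative Rbar_add.
Proof. by move=> x y; apply: val_inj; apply: Rbar_comm; exact: RbarP. Qed.
Lemma Rbar_add0 : left_id Rbar_zero Rbar_add.
Proof. by move=> x; apply: val_inj; rewrite /= mul1g. Qed.
Lemma Rbar_addN : left_inverse Rbar_zero Rbar_opp Rbar_add.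
Proof. by move=> x; apply: val_inj; rewrite /= mulVg. Qed.

HB.instance Definition _ := GRing.isZmodule.Build Rbar
  Rbar_addA Rbar_addC Rbar_add0 Rbar_addN.
HB.instance Definition _ := isPointed.Build Rbar 0%R.

Lemma val_RbarD (x y : Rbar) : val (x + y)%R = val x * val y.
Proof. by []. Qed.
Lemma val_RbarN (x : Rbar) : val (- x)%R = (val x)^-1.
Proof. by []. Qed.
Lemma val_Rbar0 : val (0%R : Rbar) = 1.
Proof. by []. Qed.

Lemma val_Rbar_continuous : continuous (val : Rbar -> Fbar).
Proof. exact: initial_continuous. Qed.

Lemma Rbar_sub_continuous : continuous (fun x : Rbar * Rbar => (x.1 - x.2)%R).
Proof.
have c1 : continuous (fun z : Rbar * Rbar => val z.1 : Fbar).
  move=> z; apply: (@cvg_comp _ _ _ fst (val : Rbar -> Fbar)).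
    exact: (@cvg_fst _ _ (nbhs z.1) (nbhs z.2)).
  exact: val_Rbar_continuous.
have c2 : continuous (fun z : Rbar * Rbar => (val z.2)^-1 : Fbar).
  move=> z; apply: (@cvg_comp _ _ _ (fun z : Rbar * Rbar => val z.2 : Fbar)
    (fun x : Fbar => x^-1)); last exact: invg_continuous.
  apply: (@cvg_comp _ _ _ snd (val : Rbar -> Fbar)).
    exact: (@cvg_snd _ _ (nbhs z.1) (nbhs z.2)).
  exact: val_Rbar_continuous.
apply: (@continuous_comp_initial _ _ _ set_val) => z.
apply: (@continuous_comp _ _ _ (fun x : Rbar * Rbar => (val x.1, (val x.2)^-1))
  (fun x : Fbar * Fbar => x.1 * x.2)); last exact: mulg_continuous.
exact: (@cvg_pair _ _ _ (nbhs z) (nbhs (val z.1 : Fbar)) (nbhs (val z.2 : Fbar)^-1)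
  _ _ _ _ _ (c1 z) (c2 z)).
Qed.

HB.instance Definition _ :=
  PreTopologicalNmodule_isTopologicalZmodule.Build Rbar Rbar_sub_continuous.

(* An arbitrary set-theoretic section of pbar; val_Rbar_act and
   ext_class_section show that the choice is immaterial. *)
Definition sec (h : H) : Fbar := xget 1 [set x | pbar x = h].

Lemma secK h : pbar (sec h) = h.
Proof.
rewrite /sec; case: xgetP => [//|]; have [a pa] := epi_surj p h.
by move=> /(_ (toFbar a)) []; rewrite /= pbarE.
Qed.

Lemma pbar_conj_subproof (x y : Fbar) : pbar y = 1 -> pbar (x * y * x^-1) = 1.
Proof. by move=> py; rewrite !pbarM py mulg1 -pbarM mulgV pbar1. Qed.

(* left action by conjugation in F/[R,R] *)
Definition Rbar_act (h : H) (y : Rbar) : Rbar :=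
  mkRbar (pbar_conj_subproof (sec h) (RbarP y)).

Lemma val_Rbar_act (x : Fbar) (y : Rbar) :
  val (Rbar_act (pbar x) y) = x * val y * x^-1.
Proof.
have pz : pbar (x^-1 * sec (pbar x)) = 1 by rewrite pbarM pbarV secK mulVg.
have := Rbar_comm pz (RbarP y).
have -> : val (Rbar_act (pbar x) y) = sec (pbar x) * val y * (sec (pbar x))^-1 by [].
have -> : sec (pbar x) = x * (x^-1 * sec (pbar x)) by rewrite mulKVg.
rewrite mulKg; move: (x^-1 * _) => z zy.
by rewrite invgM -!mulgA (mulgA z) zy -mulgA mulKVg.
Qed.

Lemma Rbar_actD h : {morph Rbar_act h : y z / (y + z)%R}.
Proof.
move=> y z; apply: val_inj.
by rewrite -[h]secK val_RbarD !val_Rbar_act val_RbarD !mulgA mulgVK.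
Qed.
Lemma Rbar_act1 : Rbar_act 1 =1 id.
Proof.
by move=> y; apply: val_inj; rewrite -pbar1 val_Rbar_act invg1 mulg1 mul1g.
Qed.
Lemma Rbar_actM g h y : Rbar_act (g * h) y = Rbar_act g (Rbar_act h y).
Proof.
apply: val_inj; rewrite -[g]secK -[h]secK -pbarM !val_Rbar_act invgM.
by rewrite !mulgA.
Qed.

HB.instance Definition _ :=
  isGModule.Build H Rbar Rbar_actD Rbar_act1 Rbar_actM.

Lemma ext_cocycle_subproof g h : pbar (sec g * sec h * (sec (g * h))^-1) = 1.
Proof. by rewrite !pbarM pbarV !secK mulgV. Qed.

Definition ext_cocycle (g h : H) : Rbar := mkRbar (ext_cocycle_subproof g h).

Lemma ext_cocycleP : is_cocycle2 ext_cocycle.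
Proof.
move=> g h k; apply/eqP; rewrite subr_eq add0r addrAC subr_eq; apply/eqP.
rewrite [RHS]addrC; apply: val_inj; rewrite !val_RbarD -[X in gact X _]secK.
rewrite val_Rbar_act /= mulgA.
rewrite [RHS]Rbar_comm; try exact: ext_cocycle_subproof.
by rewrite -!mulgA !mulKg !mulgA.
Qed.

Definition ext_class : H2 Rbar := H2_class (mkZ2 ext_cocycleP).

Lemma ext_class_section (s : H -> Fbar) (sK : cancel s pbar)
    (f : Z2 Rbar) : (forall g h, val (val f g h) = s g * s h * (s (g * h))^-1) ->
  ext_class = H2_class f.
Proof.
move=> fE; have dP h : pbar (sec h * (s h)^-1) = 1.
  by rewrite pbarM pbarV secK sK mulgV.
apply/eqP; rewrite -Quotient.idealrBE; apply/asboolP.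
exists (fun h => mkRbar (dP h)); apply/funext => g; apply/funext => h.
rewrite raddfB /= -[LHS]/(ext_cocycle g h - val f g h)%R /coboundary1.
apply/eqP; rewrite subr_eq; apply/eqP.
have E (X D C f0 : Rbar) : (X - D + C + f0 = C + X + f0 - D)%R.
  by rewrite [(X - D + C)%R]addrC addrA -!addrA [(- D + f0)%R]addrC.
rewrite E; apply: val_inj; rewrite !val_RbarD val_RbarN fE -[X in gact X _]sK.
by rewrite val_Rbar_act /= invgM invgK -!mulgA !(mulKg, mulVKg, mulKVg).
Qed.

Record autF := AutF {
  autF_fun :> F -> F;
  autFM : {morph autF_fun : a b / a * b};
  autF_bij : bijective autF_fun;
  autF_continuous : continuous autF_fun
}.

Definition A_pi : set autF := [set a | p \o a = p].

Lemma A_piE (a : A_pi) x : p (val a x) = p x.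
Proof. by have /set_mem/(congr1 (@^~ x)) := valP a. Qed.

Lemma autF_commR (a : A_pi) x :
  nsub_set (closed_commutator kerR) x -> nsub_set (closed_commutator kerR) (val a x).
Proof.
set C := commutator_set kerR; set S := smallest (@is_subgroup F) C => Sx W Wax.
have [y [Sy Wy]] := Sx _ (@autF_continuous (val a) x _ Wax).
exists (val a y); split=> //; have [S1 SM SV] := smallest_subgroup C.
have a1 : val a 1 = 1 by apply: (mulgI (val a 1)); rewrite -autFM !mulg1.
have aV z : val a z^-1 = (val a z)^-1.
  by apply: (mulgI (val a z)); rewrite -autFM !mulgV.
apply: (Sy [set y | S (val a y)]); split.
  split=> /= [|u v Su Sv|u Su]; first by rewrite a1.
    by rewrite autFM; exact: SM.
  by rewrite aV; exact: SV.
move=> _ [r [s [Rr Rs ->]]] /=; apply: sub_gen_smallest.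
exists (val a r), (val a s); split; [by rewrite /= A_piE|by rewrite /= A_piE|].
by rewrite !commgEl !conjgE !autFM !aV.
Qed.

Definition Fbar_aut (a : A_pi) (x : Fbar) : Fbar :=
  toFbar (val a (generic_quotient.repr x)).

Lemma Fbar_autE (a : A_pi) x : Fbar_aut a (toFbar x) = toFbar (val a x).
Proof.
apply/esym/coset_mapP.
have /(@autF_commR a) := repr_coset_map (closed_commutator kerR) x.
rewrite autFM; have -> // : val a x^-1 = (val a x)^-1.
apply: (mulgI (val a x)); rewrite -autFM !mulgV.
by apply: (mulgI (val a 1)); rewrite -autFM !mulg1.
Qed.

Lemma rho_subproof (a : A_pi) (y : Rbar) : pbar (Fbar_aut a (val y)) = 1.
Proof. by rewrite pbarE A_piE; exact: RbarP y. Qed.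

(* action on R/[R,R] induced by a in A(p), see Fbar_autE *)
Definition rho (a : A_pi) (y : Rbar) : Rbar := mkRbar (rho_subproof a y).
End Relation_module.

(* Main.v *)
Require Import Defs.
From HB Require Import structures.
From mathcomp Require Import fingroup perm morphism quotient gproduct.
From mathcomp Require Import all_boot all_order all_algebra finmap.
From mathcomp Require Import all_classical.
From mathcomp Require Import topology tvs.

(** An automorphism a over H acts on F/[R,R], and composing a section of
    F/[R,R] -> H with it gives another section; so rho(a) fixes the class.
    Conversely, if g fixes the class then g moves the extension cocycle by a
    coboundary, hence extends to an automorphism of F/[R,R] over H. That
    automorphism need not lift to F through an arbitrary choice of lifts of the
    images of the free generators: the lifts must again generate F. Gaschuetz'
    lemma provides generating lifts in each finite quotient of F (the number of
    generating tuples in a coset of N^d does not depend on the coset, as long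
    as the coset generates modulo N), and compactness glues them. The
    endomorphism they define is surjective, and it is injective because
    precomposition with it permutes each finite set Hom(F, Q). *)

Set Implicit Arguments.
Unset Strict Implicit.
Unset Printing Implicit Defensive.

Import GRing.Theory.
Local Open Scope group_scope.

(** * Gaschuetz' lemma *)

Section Gaschutz.
Variables (gT : finGroupType) (I : finType) (G N : {group gT}).
Hypothesis nNG : N <| G.
Implicit Types (t z : {ffun I -> gT}) (L M : {group gT}).

Definition tuple_gen t : {group gT} := <<[set t i | i : I]>>%G.

Definition tuple_congr z t := [forall i, (z i)^-1 * t i \in N].

Definition count_gen L z :=
  #|[set t | tuple_congr z t && (tuple_gen t == L)]|.

Lemma tuple_gen_sub t L : (tuple_gen t \subset L) = [forall i, t i \in L].
Proof.
rewrite gen_subG; apply/fintype.subsetP/forallP => [tL i|tL _ /imsetP[i _ ->]//].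
by apply: tL; apply: imset_f.
Qed.

(** The tuple [z] lies in [G] and its image generates [G / N]. *)
Definition gen_mod z := (tuple_gen z \subset G) && (G \subset N * tuple_gen z).

(** Each [z i] differs from [t i] by an element of [N], so [N * L] absorbs the group generated by
    [z], hence [G]. In the counting below this rules out the subgroups that do not supplement
    [N]. *)
Lemma congr_gen_mod z t L : tuple_congr z t -> tuple_gen t \subset L ->
  L \subset G -> gen_mod z -> G \subset N * L.
Proof.
move=> /forallP zt; rewrite tuple_gen_sub => /forallP tL LG /andP[_ Gz].
have nNL : L \subset 'N(N) by apply: fintype.subset_trans LG (normal_norm nNG).
apply: (fintype.subset_trans Gz); rewrite -(norm_joinEr nNL) mul_subG ?joing_subl //.
rewrite tuple_gen_sub; apply/forallP => i.
have -> : z i = t i * ((z i)^-1 * t i)^-1 by rewrite invMg invgK mulKVg.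
apply: groupM; first exact: (fintype.subsetP (joing_subr N L)).
by rewrite groupV; apply: (fintype.subsetP (joing_subl N L)).
Qed.

(** As [N * L] covers [G], the cosets of [z i] and [z' i] modulo [N] contain elements [l i] and
    [l' i] of [L]. Right multiplication by [(l i)^-1 * l' i] is an injection from the first set to
    the second. The hypotheses are symmetric in [z] and [z'], so equality follows by exchanging
    them. *)
Lemma card_congr_sub z z' L : L \subset G -> G \subset N * L ->
  tuple_gen z \subset G -> tuple_gen z' \subset G ->
  #|[set t | tuple_congr z t && (tuple_gen t \subset L)]| <=
  #|[set t | tuple_congr z' t && (tuple_gen t \subset L)]|.
Proof.
move=> LG GNL; rewrite !tuple_gen_sub => /forallP zG /forallP z'G.
have nNL : L \subset 'N(N) by apply: fintype.subset_trans LG (normal_norm nNG).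
have ex u : u \in G -> exists l, (l \in L) && (u^-1 * l \in N).
  rewrite -(normC nNL) in GNL; move/(fintype.subsetP GNL)/mulsgP => [l n Ll Nn ->].
  by exists l; rewrite Ll invMg mulgKV groupV.
pose l i := xchoose (ex _ (zG i)); pose l' i := xchoose (ex _ (z'G i)).
pose f t : {ffun I -> gT} := [ffun i => t i * (l i)^-1 * l' i].
have f_inj : injective f.
  move=> t t' /ffunP ff; apply/ffunP => i.
  by have := ff i; rewrite !ffunE => /mulIg/mulIg.
rewrite -(card_imset _ f_inj); apply/subset_leq_card/fintype.subsetP => _ /imsetP[t + ->].
rewrite !inE !tuple_gen_sub => /andP[/forallP zt /forallP tL].
apply/andP; split; apply/forallP => i; rewrite ffunE;
  have /andP[lL lN] := xchooseP (ex _ (zG i));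
  have /andP[l'L l'N] := xchooseP (ex _ (z'G i)).
  (* The new entry, taken relative to [z' i], becomes a conjugate by an element of [G] of an element
     of [N], times an element of [N]. *)
  rewrite (_ : _ * _ = (((z i)^-1 * t i) * ((z i)^-1 * l i)^-1) ^ ((z i)^-1 * z' i) *
      ((z' i)^-1 * l' i)); last first.
    by rewrite conjgE !invMg !invgK !mulgA !(mulgK, mulgKV).
  have nN u : u \in G -> u \in 'N(N) by apply/fintype.subsetP/normal_norm.
  apply: groupM => //; rewrite memJ_norm; first by apply: groupM; rewrite ?groupV.
  by apply: groupM; rewrite ?groupV nN.
by rewrite !groupM ?groupV.
Qed.

Lemma card_congr_sum z L :
  #|[set t | tuple_congr z t && (tuple_gen t \subset L)]| =
  \sum_(M : {group gT} | M \subset L) count_gen M z.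
Proof.
rewrite -sum1_card (partition_big tuple_gen (fun M : {group gT} => M \subset L)).
  apply: eq_bigr => M ML; rewrite /count_gen -sum1_card.
  apply: eq_bigl => t; rewrite !inE.
  have [tM|_] := eqVneq (tuple_gen t) M; last by rewrite !andbF.
  by rewrite tM ML !andbT.
by move=> t; rewrite inE => /andP[].
Qed.

(** Strong induction on the order of [L]. The tuples of the coset with all entries in [L] are
    equally many for [z] and [z']; sort them by the subgroup [M] they generate. For proper [M] the
    counts agree by induction if [N * M] covers [G], and otherwise both vanish. What remains is the
    count for [L] itself. *)
Lemma count_gen_indep z z' L : gen_mod z -> gen_mod z' -> L \subset G ->
  G \subset N * L -> count_gen L z = count_gen L z'.
Proof.
move=> gz gz'; have [n] := ubnP #|L|; elim: n L => // n IHn L /ltnSE leLn LG GNL.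
have /andP[zG _] := gz; have /andP[z'G _] := gz'.
have : #|[set t | tuple_congr z t && (tuple_gen t \subset L)]| =
       #|[set t | tuple_congr z' t && (tuple_gen t \subset L)]|.
  by apply/eqP; rewrite eqn_leq !card_congr_sub.
rewrite !card_congr_sum (bigD1 L) //= [in RHS](bigD1 L) //=.
rewrite (eq_bigr (count_gen^~ z')); first by move/addIn.
move=> M /andP[ML neML].
have MG : M \subset G by apply: fintype.subset_trans LG.
have [GNM|GNM] := boolP (G \subset N * M).
  apply: IHn => //; apply: leq_trans leLn; apply: proper_card.
  by rewrite finset.properEneq ML andbT.
rewrite /count_gen !eq_card0 // => t; rewrite !inE; apply/negP => /andP[zt /eqP tM];
  by case/negP: GNM; apply: congr_gen_mod zt _ MG _ => //; rewrite tM.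
Qed.

(** The coset of [x] contains the generating tuple [x], so its count is positive, and the coset of
    [z] has the same count. *)
Lemma gaschutz x z : tuple_gen x = G -> gen_mod z ->
  exists2 t, tuple_congr z t & tuple_gen t = G.
Proof.
move=> xG gz; have gx : gen_mod x by rewrite /gen_mod xG subxx mulG_subr.
have : 0 < count_gen G z.
  rewrite (count_gen_indep gz gx) // ?mulG_subr //; apply/card_gt0P; exists x.
  by rewrite inE xG eqxx andbT; apply/forallP => i; rewrite mulVg group1.
by case/card_gt0P => t; rewrite inE => /andP[zt /eqP]; exists t.
Qed.
End Gaschutz.

Local Open Scope classical_set_scope.

(** * Zero-dimensionality *)

Section ZeroDimensional.
Variable T : topologicalType.
Hypotheses (hT : hausdorff_space T) (cT : compact [set: T]).

Definition quasi_component (x : T) : set T :=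
  [set y | forall C, clopen C -> C x -> C y].

Lemma quasi_component_closed x : closed (quasi_component x).
Proof.
rewrite (_ : quasi_component x = \bigcap_(C in [set C | clopen C /\ C x]) C).
  by apply: closed_bigI => C [[_ cC] _].
by apply/seteqP; split=> [y Qy C [cC Cx]|y Qy C cC Cx]; exact: Qy.
Qed.

(** If no clopen neighbourhood of [x] fits into [W], these neighbourhoods trace a proper filter on
    the compact complement of [W]; a cluster point of it would lie in the quasi-component but
    outside [W]. *)
Lemma quasi_component_nbhs x (W : set T) : open W ->
  quasi_component x `<=` W -> exists C, [/\ clopen C, C x & C `<=` W].
Proof.
move=> oW QW.
have cW : compact (~` W) by apply: (subclosed_compact _ cT) => //; exact: open_closedC.
pose G := filter_from [set C : set T | clopen C /\ C x] id.
have FG : Filter G.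
  apply: filter_from_filter; first by exists setT; split => //; exact: clopenT.
  by move=> A B [? ?] [? ?]; exists (A `&` B) => //; split=> //; exact: clopenI.
have [W0|W0] := pselect (exists C, [/\ clopen C, C x & C `<=` W]); first by [].
have PG : ProperFilter (within (~` W) G).
  apply: Build_ProperFilter_ex => B [C [cC Cx] CB]; apply: contrapT => B0.
  apply: W0; exists C; split=> // y Cy; apply: contrapT => Wy.
  by apply: B0; exists y; exact: CB.
have [|y [Wy cy]] := cW _ PG.
  by exists setT; [split=> //; exact: clopenT|].
exfalso; apply: Wy; apply: QW => C [oC cC] Cx; apply: (cC) => V Vy.
by apply: (cy C V) => //; exists C => // z Cz _.
Qed.

(** In a compact Hausdorff space a quasi-component cannot split into two nonempty disjoint closed
    parts, because normality would yield a clopen set around [x] that misses one of them. *)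
Lemma quasi_component_connected x : connected (quasi_component x).
Proof.
move=> B [b Bb] [O oO BO] [D cD BD].
have Qx : quasi_component x x by [].
have cQ := @quasi_component_closed x.
have sub (U V : set T) : closed U -> closed V -> U `&` V = set0 ->
    quasi_component x `<=` U `|` V -> U x -> quasi_component x `<=` U.
  move=> cU cV UV QUV Ux.
  have nU : set_nbhs U (~` V).
    apply/set_nbhsP; exists (~` V); split=> //; first exact: closed_openC.
    exact/disjoints_subset.
  have [W nW WV] := compact_normal hT cT cU nU.
  have /set_nbhsP[O' [oO' UO' O'W]] := nW.
  (* Here [U] lies in the open [O'] and the closure of [W] misses [V], so this open set covers the
     quasi-component. Inside [C] the set [O'] coincides with the closure of [W], which makes its
     trace on [C] clopen. *)
  have [||C [[oC cC] Cx CO]] := @quasi_component_nbhs x (O' `|` ~` closure W).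
  - by apply: openU => //; exact/closed_openC/closed_closure.
  - by move=> y /QUV [/UO' ?|Vy]; [left|right => /WV].
  have cCO : clopen (C `&` O').
    split; first exact: openI.
    rewrite (_ : C `&` O' = C `&` closure W);
      first by apply: closedI => //; exact: closed_closure.
    apply/seteqP; split=> y [Cy]; first by move=> /O'W/subset_closure.
    by move=> Wy; split=> //; case: (CO _ Cy).
  move=> y Qy; have [//|Vy] := QUV y Qy.
  by have [_ /O'W/subset_closure/WV] := Qy _ cCO (conj Cx (UO' _ Ux)).
have QO : quasi_component x `&` ~` O = quasi_component x `\` B.
  by rewrite BO setDIr setDv set0U.
have cQB : closed (quasi_component x `\` B).
  by rewrite -QO; apply: closedI => //; exact: open_closedC.
have cB : closed B by rewrite BD; exact: closedI.
have BQ : B `<=` quasi_component x by rewrite BO => y [].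
have [Bx|Bx] := pselect (B x).
  apply/seteqP; split=> //; apply: (sub B (quasi_component x `\` B)) => //.
    by apply/disjoints_subset => y By [].
  by move=> y Qy; have [|] := pselect (B y); [left|right].
have : quasi_component x `<=` quasi_component x `\` B.
  apply: (sub _ B) => //; first by apply/disjoints_subset => y [].
  by move=> y Qy; have [|] := pselect (B y); [right|left].
by move=> /(_ b (BQ _ Bb)) [].
Qed.

Lemma compact_totally_disconnected_zero_dimensional :
  totally_disconnected [set: T] -> zero_dimensional T.
Proof.
move=> tT x y xy; apply: contrapT => nC.
have : quasi_component x y.
  by move=> C cC Cx; apply: contrapT => Cy; apply: nC; exists C.
have := tT x I; rewrite eqEsubset => -[+ _] => /(_ y) txy Qy.
suff yx : y = x by rewrite yx eqxx in xy.
apply: txy; exists (quasi_component x) => //; split => //.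
exact: quasi_component_connected.
Qed.
End ZeroDimensional.

(** * Finite quotients of profinite groups *)

Section DiscreteFiniteGroup.
Variable Q : finGroupType.
Local Notation DQ := (discrete_topology Q).

HB.instance Definition _ := monoid.Group.on DQ.

Lemma discrete_mulg_continuous : continuous (fun x : DQ * DQ => x.1 * x.2).
Proof.
move=> x; apply/discrete_cvg.
exists ([set x.1], [set x.2]); first by split; exact: discrete_set1.
by move=> [a b] /= [-> ->].
Qed.

Lemma discrete_invg_continuous : continuous (fun x : DQ => x^-1).
Proof.
move=> x W /nbhs_singleton Wx; rewrite nbhs_simpl /=.
by rewrite nbhs_principalE; exact/principal_filterP.
Qed.

HB.instance Definition _ := Group_isTopological.Build DQ
  discrete_mulg_continuous discrete_invg_continuous.

Lemma discrete_compact : compact [set: DQ].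
Proof. exact/finite_compact/finite_finset. Qed.

(** This makes finite groups admissible targets for the universal property of [free_profinite]. *)
HB.instance Definition _ := TopGroup_isProfinite.Build DQ discrete_compact
  discrete_hausdorff
  (zero_dimension_totally_disconnected discrete_zero_dimension).
End DiscreteFiniteGroup.

Section TopologicalGroups.
Variable G : topGroupType.

Lemma mulg_near (a b : G) (W : set G) : nbhs (a * b) W ->
  exists U V, [/\ nbhs a U, nbhs b V & forall x y, U x -> V y -> W (x * y)].
Proof.
move=> /(@mulg_continuous G (a, b)) [[U V] /= [Ua Vb] UV].
by exists U, V; split=> // x y Ux Vy; exact: (UV (x, y)).
Qed.

Lemma mulg_continuousl (a : G) : continuous (fun x => a * x).
Proof.
move=> x W /mulg_near [U [V [Ua Vx UV]]]; apply: filterS Vx => y /= Vy.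
by apply: UV => //; exact: nbhs_singleton.
Qed.
End TopologicalGroups.

Lemma morph_continuous (G K : topGroupType) (f : G -> K) :
  {morph f : a b / a * b} -> (forall W, nbhs 1 W -> nbhs 1 (f @^-1` W)) ->
  continuous f.
Proof.
move=> fM f1 a W Wfa.
have /f1 : nbhs 1 ((fun y => f a * y) @^-1` W).
  by apply: (@mulg_continuousl K); rewrite mulg1.
rewrite -[in X in nbhs X](mulVg a) => /(@mulg_continuousl G a^-1 a).
by rewrite nbhs_simpl /=; apply: filterS => x /=; rewrite -fM mulKVg.
Qed.

Section Morphisms.
Variables (G K : monoid.Group.type) (f : G -> K).
Hypothesis fM : {morph f : a b / a * b}.

Lemma hom1 : f 1 = 1.
Proof. by apply: (mulgI (f 1)); rewrite -fM !mulg1. Qed.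

Lemma homV : {morph f : a / a^-1}.
Proof. by move=> a; apply: (mulgI (f a)); rewrite -fM !mulgV hom1. Qed.
End Morphisms.

Lemma locally_constant_finite (T : topologicalType) (Y : Type) (f : T -> Y) :
  compact [set: T] -> (forall x, \forall y \near x, f y = f x) ->
  finite_set (range f).
Proof.
move=> /compact_near_coveringP cT fl.
(* The index filter consists of the eventually large finite sets of values. Compactness in
   near-covering form then gives one finite set that contains every value. *)
pose G := filter_from (@finite_set Y) (fun D0 => [set D | finite_set D /\ D0 `<=` D]).
have FG : Filter G.
  apply: filter_from_filter; first by exists set0.
  move=> A B fA fB; exists (A `|` B); first by rewrite finite_setU.
  by move=> D [fD ABD]; split; split=> // y ?; apply: ABD; [left|right].
have [|A fA AP] := cT _ G (fun D x => D (f x)) FG.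
  move=> x _; exists (f @^-1` [set f x], [set D | D (f x)]); last first.
    by move=> [y D] /= [->].
  split=> /=; first exact: fl.
  by exists [set f x] => // D [_ ]; apply.
have {}AP := AP A (conj fA (fun _ => id)).
by apply: sub_finite_set fA => _ [x _ <-]; exact: AP.
Qed.

Definition cont_hom (G : topGroupType) (Q : finGroupType) (q : G -> Q) :=
  {morph q : a b / a * b} /\ continuous (q : G -> discrete_topology Q).

Section FiniteQuotients.
Variable F : profiniteGroupType.

(* F permutes the translates C a^-1, which are finitely many; if a acts
   trivially then C a^-1 = C contains 1, that is, C contains a. *)
Lemma clopen_finite_quotient (C : set F) : clopen C -> C 1 ->
  exists (Q : finGroupType) (q : F -> Q),
    cont_hom q /\ forall a, q a = 1 -> C a.
Proof.
move=> [oC cC] C1.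
have Cl (c : F) : \forall x \near c, C x <-> C c.
  have [Cc|nCc] := pselect (C c).
    by have : nbhs c C; [exact: open_nbhs_nbhs|apply: filterS].
  have : nbhs c (~` C) by apply: open_nbhs_nbhs; split => //; exact: closed_openC.
  by apply: filterS => x /= nCx; split.
(* A factor [g] close to 1 can be inserted anywhere in a product without changing membership in [C];
   compactness of F x F makes this uniform in [c] and [d]. *)
have stab1 : \forall g \near (1 : F), forall c d, C (c * g * d) <-> C (c * d).
  have /compact_near_coveringP cFF :=
    compact_setX (@profinite_compact F) (@profinite_compact F).
  pose P (g : F) (cd : F * F) := C (cd.1 * g * cd.2) <-> C (cd.1 * cd.2).
  have : \forall g \near (1 : F), [set: F] `*` [set: F] `<=` P g.
    apply: cFF => -[c d] _.
    have /mulg_near [U [V [Uc Vd UV]]] := Cl (c * d).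
    have /mulg_near [U' [V' [U'c V'1 UV']]] : nbhs (c * 1) U by rewrite mulg1.
    exists ((U `&` U') `*` V, V') => /=.
      by split=> //; exists (U `&` U', V) => //=; split=> //; exact: filterI.
    move=> [[x y] g] /= [[[Ux U'x] Vy] V'g].
    by rewrite /P /= (UV x y) // (UV (x * g) y) //; exact: UV'.
  by apply: filterS => g Cg c d; apply: (Cg (c, d)).
(* [X a] is the translate [C a^-1]. It is locally constant in [a] by [stab1], hence takes finitely
   many values. *)
pose X (a : F) : set F := [set c | C (c * a)].
have XV a g : (forall c d, C (c * g * d) <-> C (c * d)) -> X (a * g) = X a.
  by move=> Cg; apply/seteqP; split=> c; rewrite /X /= mulgA -[_ * g]mulg1 Cg mulg1.
have Xl a : \forall b \near a, X b = X a.
  have /(@mulg_continuousl _ a^-1 a) : nbhs (a^-1 * a)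
      [set g | forall c d, C (c * g * d) <-> C (c * d)].
    by rewrite mulVg.
  by rewrite nbhs_simpl /=; apply: filterS => b /= /(XV a); rewrite mulKVg.
have finX := locally_constant_finite (@profinite_compact F) Xl.
pose T : finType := fset_set (range X).
pose tr (a : F) (Y : set F) : set F := [set c | Y (c * a)].
have trX a b : tr a (X b) = X (a * b).
  by apply/seteqP; split=> c; rewrite /tr /X /= mulgA.
have trT a (Y : T) : tr a (val Y) \in fset_set (range X).
  have := valP Y; rewrite !in_fset_set // => /set_mem [b _ <-].
  by apply/mem_set; exists (a * b); rewrite ?trX.
pose act a (Y : T) : T := [` trT a Y]%fset.
have actM a b Y : act (a * b) Y = act a (act b Y).
  by apply: val_inj; apply/seteqP; split=> c; rewrite /= /tr /= mulgA.
have act1 Y : act 1 Y = Y.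
  by apply: val_inj; apply/seteqP; split=> c; rewrite /= /tr /= mulg1.
have act_inj a : injective (act a).
  by apply: (can_inj (g := act a^-1)) => Y; rewrite -actM mulVg act1.
(* The inverse turns the left action into a homomorphism, since products of permutations compose
   from left to right. *)
exists {perm T}, (fun a => perm (@act_inj a^-1)).
have qM : {morph (fun a => perm (@act_inj a^-1)) : a b / a * b}.
  by move=> a b; apply/perm.permP => Y; rewrite permM !permE invgM actM.
split; first split=> //.
  apply: (@morph_continuous _ (discrete_topology {perm T})) => // W W1.
  have : nbhs (1 : F) [set g | forall c d, C (c * g^-1 * d) <-> C (c * d)].
    apply: (@invg_continuous F 1 [set g | forall c d, C (c * g * d) <-> C (c * d)]).
    by rewrite invg1.
  apply: filterS => g Cg /=.
  rewrite (_ : perm _ = 1); first exact: (nbhs_singleton W1).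
  apply/perm.permP => Y; rewrite permE perm1; apply: val_inj.
  have := valP Y; rewrite in_fset_set // => /set_mem [b _ YE].
  by rewrite /= -YE trX; apply/seteqP; split=> c; rewrite /X /= mulgA Cg.
move=> a /perm.permP qa.
have Xa : X a \in fset_set (range X) by rewrite in_fset_set //; apply/mem_set; exists a.
have /(congr1 val)/seteqP[+ _] := qa [` Xa]%fset.
by rewrite permE perm1 /= trX mulVg => /(_ 1); rewrite /X /= !mul1g; apply.
Qed.

Lemma finite_quotient (U : set F) : nbhs 1 U ->
  exists (Q : finGroupType) (q : F -> Q),
    cont_hom q /\ forall a, q a = 1 -> U a.
Proof.
have zF := compact_totally_disconnected_zero_dimensional
  (@profinite_hausdorff F) (@profinite_compact F) (@profinite_totally_disconnected F).
move=> /(zero_dimensional_cvg (@profinite_hausdorff F) zF (@profinite_compact F)).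
move=> [C [C1 cC] CU]; have [Q [q [qc qC]]] := clopen_finite_quotient cC C1.
by exists Q, q; split=> // a /qC/CU.
Qed.
End FiniteQuotients.

(** * Free profinite groups *)

Section ContHom.
Variable G : topGroupType.

Lemma cont_hom_ker (Q : finGroupType) (q : G -> Q) : cont_hom q ->
  \forall a \near (1 : G), q a = 1.
Proof.
move=> [qM qC]; have := @discrete_set1 (discrete_topology Q) (q 1).
move=> /(qC (1 : G)); rewrite nbhs_simpl /=; apply: filterS => a /= ->.
exact: (hom1 qM).
Qed.

Lemma cont_homP (Q : finGroupType) (q : G -> Q) : {morph q : a b / a * b} ->
  (\forall a \near (1 : G), q a = 1) -> cont_hom q.
Proof.
move=> qM q1; split=> //; apply: (@morph_continuous _ (discrete_topology Q)) => // W.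
by move=> /nbhs_singleton W1; apply: filterS q1 => a /= ->.
Qed.

Lemma cont_hom_comp (K : topGroupType) (f : K -> G) (Q : finGroupType) (q : G -> Q) :
  {morph f : a b / a * b} -> continuous f -> cont_hom q -> cont_hom (q \o f).
Proof.
move=> fM fC [qM qC]; split=> [a b|a] /=; first by rewrite fM qM.
by apply: continuous_comp; [exact: fC|exact: qC].
Qed.

Lemma comp_cont_hom (Q Q' : finGroupType) (q : G -> Q) (f : Q -> Q') : cont_hom q ->
  (forall a b, f (q a * q b) = f (q a) * f (q b)) -> cont_hom (f \o q).
Proof.
move=> qC fM; apply: cont_homP => [a b|] /=; first by have [-> _] := qC.
have f1 : f 1 = 1.
  apply: (mulgI (f 1)); have := fM 1 1; have [qM _] := qC.
  by rewrite (hom1 qM) !mulg1.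
by apply: filterS (cont_hom_ker qC) => a /= ->.
Qed.

Lemma cont_hom_pair (Q Q' : finGroupType) (q : G -> Q) (q' : G -> Q') :
  cont_hom q -> cont_hom q' -> cont_hom (fun a => (q a, q' a)).
Proof.
move=> qC q'C; apply: cont_homP => [a b|].
  by have [-> _] := qC; have [-> _] := q'C.
apply: filterS2 (cont_hom_ker qC) (cont_hom_ker q'C) => a /= -> -> //.
Qed.
End ContHom.

Definition image_gen (G : topGroupType) (Q : finGroupType) (I : finType) (q : G -> Q)
  (y : I -> G) : {group Q} := <<[set q (y i) | i : I]>>%G.

(* For G profinite: y generates G topologically. *)
Definition gen_finite (G : topGroupType) (I : finType) (y : I -> G) :=
  forall (Q : finGroupType) (q : G -> Q), cont_hom q -> forall a, q a \in image_gen q y.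

(** The homomorphism with components [f] and [g] sends the generators into the diagonal of [Q * Q],
    which is a subgroup and therefore contains the whole image. *)
Lemma gen_finite_eq (G : topGroupType) (I : finType) (y : I -> G) (Q : finGroupType)
  (f g : G -> Q) : gen_finite y -> cont_hom f -> cont_hom g ->
  (forall i, f (y i) = g (y i)) -> f =1 g.
Proof.
move=> gy fC gC fg a.
pose D := [set u : Q * Q | u.1 == u.2]%SET.
have gD : group_set D.
  apply/group_setP; split=> [|u v]; rewrite !inE //= => /eqP-> /eqP-> //.
have /fintype.subsetP sD : image_gen (fun a => (f a, g a)) y \subset group gD.
  by rewrite gen_subG; apply/fintype.subsetP => _ /imsetP[i _ ->]; rewrite inE fg /=.
by have /sD := gy _ _ (cont_hom_pair fC gC) a; rewrite inE /= => /eqP.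
Qed.

Lemma image_group (G : groupType) (Q : finGroupType) (q : G -> Q) (S : set G) :
  {morph q : a b / a * b} -> is_subgroup S ->
  exists A : {group Q}, forall u, u \in A <-> exists2 s, S s & q s = u.
Proof.
move=> qM [S1 SM SV]; pose D := [set u : Q | `[< exists2 s, S s & q s = u >]]%SET.
have DE u : (u \in D) = `[< exists2 s, S s & q s = u >] by exact: finset.in_set.
have gD : group_set D.
  apply/group_setP; split=> [|u v]; rewrite !DE.
    by apply/asboolP; exists 1 => //; exact: (hom1 qM).
  move=> /asboolP[s Ss <-] /asboolP[s' Ss' <-]; apply/asboolP.
  by exists (s * s'); [exact: SM|rewrite qM].
by exists (group gD) => u; rewrite -[_ \in _]/(u \in D) DE; split=> /asboolP.
Qed.

(** The image of [S] in any finite quotient is a subgroup containing the images of the generators,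
    hence the image of [a]. As finite quotients detect neighbourhoods of 1, [S] meets every
    neighbourhood of [a]. *)
Lemma closed_subgroup_gen (F : profiniteGroupType) (I : finType) (y : I -> F)
    (S : set F) :
  gen_finite y -> closed S -> is_subgroup S -> (forall i, S (y i)) -> forall a, S a.
Proof.
move=> gy cS [S1 SM SV] Sy a; apply: cS => W Wa.
have : nbhs (1 : F) ((fun w => a * w) @^-1` W).
  by apply: (@mulg_continuousl F); rewrite mulg1.
move=> /finite_quotient[Q [q [qC qW]]].
have [qM _] := qC; have [A AP] := image_group qM (And3 S1 SM SV).
have /fintype.subsetP sA : image_gen q y \subset A.
  by rewrite gen_subG; apply/fintype.subsetP => _ /imsetP[i _ ->]; apply/AP; exists (y i).
have /sA/AP[s Ss qs] := gy _ _ qC a.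
exists s; split=> //; rewrite -(mulKVg a s); apply: qW.
by rewrite qM (homV qM) qs mulVg.
Qed.

Section Free.
Variables (d : nat) (F : profiniteGroupType) (x : 'I_d -> F).
Hypothesis hF : free_profinite x.

Lemma free_lift (Q : finGroupType) (t : 'I_d -> Q) :
  exists2 f : F -> Q, cont_hom f & forall i, f (x i) = t i.
Proof. by have [f [[fM fC fx] _]] := hF (t : _ -> discrete_topology Q); exists f. Qed.

Lemma free_eq (Q : finGroupType) (f g : F -> Q) : cont_hom f -> cont_hom g ->
  (forall i, f (x i) = g (x i)) -> f = g.
Proof.
move=> [fM fC] [gM gC] fg.
have [h [_ hU]] := hF (g \o x : _ -> discrete_topology Q).
have -> : f = h by apply/esym/hU.
exact: hU.
Qed.

(** The universal property gives a homomorphism into the subgroup [L] generated by the images of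
    [x]; followed by the inclusion it agrees with [q] on [x], so it is [q]. *)
Lemma free_gen_finite : gen_finite x.
Proof.
move=> Q q qC a; set L := image_gen q x.
have Lx i : q (x i) \in L by apply: mem_gen; apply: imset_f.
have [f fC fx] := free_lift (fun i => subg L (q (x i))).
have <- : (sgval \o f) = q; last exact: subgP.
apply: free_eq => // [|i]; last by rewrite /= fx subgK.
by apply: comp_cont_hom.
Qed.

Lemma free_hopfian (y : 'I_d -> F) (f : F -> F) : gen_finite y ->
  {morph f : a b / a * b} -> continuous f -> (forall i, f (x i) = y i) ->
  bijective f.
Proof.
move=> gy fM fC fx.
have f_inj a : f a = 1 -> a = 1.
  move=> fa; apply: contrapT => na.
  have : nbhs (1 : F) (~` [set a]).
    apply: open_nbhs_nbhs; split; last by move=> /= /esym.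
    apply: closed_openC; apply: accessible_closed_set1.
    exact/hausdorff_accessible/profinite_hausdorff.
  move=> /finite_quotient[Q [q [qC qa]]].
  have qa1 : q a <> 1 by move=> /qa; apply.
  pose lift (t : {ffun 'I_d -> Q}) : F -> Q := sval (cid2 (free_lift t)).
  have liftC t : cont_hom (lift t) by rewrite /lift; case: cid2.
  have liftx t i : lift t (x i) = t i by rewrite /lift; case: cid2.
  (* Homomorphisms from F to [Q] correspond to tuples in [Q], and [Phi] is precomposition with [f]
     in these terms. It is injective because [y] generates, hence bijective; so [q] factors through
     [f], and [f a = 1] would force [q a = 1]. *)
  pose Phi (t : {ffun 'I_d -> Q}) : {ffun 'I_d -> Q} := [ffun i => lift t (y i)].
  have Phi_inj : injective Phi.
    move=> t t' /ffunP tt'; apply/ffunP => i; rewrite -!liftx.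
    by apply: (gen_finite_eq gy) => // j; have := tt' j; rewrite !ffunE.
  pose t := invF Phi_inj [ffun i => q (x i)].
  have Et : lift t \o f = q.
    apply: free_eq => // [|i]; first exact: cont_hom_comp.
    have /ffunP/(_ i) := f_invF Phi_inj [ffun i => q (x i)].
    by rewrite !ffunE /= fx.
  by apply: qa1; rewrite -Et /= fa; have [lM _] := liftC t; apply: (hom1 lM).
have fi : injective f.
  move=> a b fab; apply: (mulgI (b^-1)); rewrite mulVg; apply: f_inj.
  by rewrite fM (homV fM) fab mulVg.
(* The image is compact, so closed, and it contains the generators [y]. *)
have fs : forall b, range f b.
  apply: (closed_subgroup_gen gy).
  - apply: compact_closed; first exact: profinite_hausdorff.
    apply: continuous_compact (@profinite_compact F).
    exact: continuous_subspaceT.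
  - split; first by exists 1 => //; exact: (hom1 fM).
      by move=> _ _ [a _ <-] [b _ <-]; exists (a * b).
    by move=> _ [a _ <-]; exists a^-1 => //; exact: (homV fM).
  - by move=> i; exists (x i).
pose g b := sval (cid2 (fs b)).
have fg : cancel g f by move=> b; rewrite /g; case: cid2.
by exists g => // a; apply: fi; rewrite fg.
Qed.
End Free.

(** * Automorphisms of F/[R,R] *)

Lemma coset_map_nbhs (G : topGroupType) (N : normalSubgroup G) (c : G) (W : set G) :
  nbhs c W -> nbhs (coset_map N c) (coset_map N @` W).
Proof.
rewrite nbhsE => -[W' [oW' W'c] WW']; rewrite nbhsE.
exists (coset_map N @` W'); last exact: image_subset.
by split; [exact: coset_map_open|exists c].
Qed.

(** If [a^-1 * b] is outside the closed set [N], so are all products of points near [a^-1] and near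
    [b]; the images of the corresponding neighbourhoods of [a] and [b] are then disjoint. *)
Lemma quotg_hausdorff (G : topGroupType) (N : normalSubgroup G) :
  closed (nsub_set N) -> hausdorff_space (quotg N).
Proof.
move=> cN u v; rewrite -[u]coset_map_repr -[v]coset_map_repr.
move: (repr u) (repr v) => a b cab; apply: contrapT => ab.
have Nab : ~ nsub_set N (a^-1 * b) by move=> /coset_mapP.
have /mulg_near [U [V [Ua Vb UV]]] : nbhs (a^-1 * b) (~` nsub_set N).
  by apply: open_nbhs_nbhs; split => //; exact: closed_openC.
have /(@invg_continuous G a) Ua' := Ua.
have [_ [[x Ux <-] [y Vy /coset_mapP Nxy]]] :=
  cab _ _ (coset_map_nbhs N Ua') (coset_map_nbhs N Vb).
apply: (UV x^-1 y) => //.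
have [_ NM NV] := nsub_subgroup N.
by have := NV _ Nxy; rewrite invgM invgK.
Qed.

Section Fbar.
Variables (F : topGroupType) (H : finGroupType) (p : contEpi F H).
Local Notation Fbar := (Fbar p).
Local Notation Rbar := (Rbar p).

Lemma Fbar_hausdorff : hausdorff_space Fbar.
Proof. by apply: quotg_hausdorff; exact: closed_closure. Qed.

Lemma Rbar_hausdorff : hausdorff_space Rbar.
Proof.
move=> a b cab; apply: val_inj; apply: Fbar_hausdorff => U V Ua Vb.
have [c [Uc Vc]] :=
  cab _ _ (@val_Rbar_continuous _ _ p a _ Ua) (@val_Rbar_continuous _ _ p b _ Vb).
by exists (val c).
Qed.

(** Because of this, continuity of a homomorphism on F/[R,R] can be tested on R/[R,R]. *)
Lemma Rbar_set_open : open (@Rbar_set F H p).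
Proof.
apply: coset_map_open.
rewrite (_ : nsub_set _ = (p : F -> discrete_topology H) @^-1` [set 1]) //.
apply: open_comp => [? _|]; [exact: epi_continuous|exact: discrete_open].
Qed.

Lemma Rpart_subproof (x : Fbar) : pbar (x * (sec p (pbar x))^-1) = 1.
Proof. by rewrite pbarM pbarV secK mulgV. Qed.

(** The first coordinate in the normal form r s(h) of an element of F/[R,R], where s is the chosen
    section. *)
Definition Rpart (x : Fbar) : Rbar := mkRbar (Rpart_subproof x).

Lemma RpartK x : val (Rpart x) * sec p (pbar x) = x.
Proof. by rewrite /= mulgVK. Qed.

Lemma Rpart_mul (a : Rbar) h : Rpart (val a * sec p h) = a.
Proof. by apply: val_inj; rewrite /= pbarM RbarP secK mul1g mulgK. Qed.

Lemma pbar_mul_sec (a : Rbar) h : pbar (val a * sec p h) = h.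
Proof. by rewrite pbarM RbarP secK mul1g. Qed.

(** In the coordinates r s(h), multiplication is the crossed product given by the extension
    cocycle. *)
Lemma mul_sec (a b : Rbar) g h : (val a * sec p g) * (val b * sec p h) =
  val (a + gact g b + ext_cocycle p g h)%R * sec p (g * h).
Proof. by rewrite !val_RbarD -!mulgA mulVg mulg1 mulKg. Qed.

(* An automorphism g of R/[R,R] that moves the extension cocycle by the
   coboundary of b extends to the automorphism a s(h) |-> g(a) b(h) s(h). *)
Section Extension.
Variables (g : zhatGAut Rbar) (b : H -> Rbar).
Hypothesis gb : forall h k,
  (g (ext_cocycle p h k) - ext_cocycle p h k = coboundary1 b h k)%R.

Definition extend (x : Fbar) : Fbar := val (g (Rpart x) + b (pbar x))%R * sec p (pbar x).

Lemma pbar_extend x : pbar (extend x) = pbar x.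
Proof. exact: pbar_mul_sec. Qed.

Lemma extend_mul_sec (a : Rbar) h :
  extend (val a * sec p h) = val (g a + b h)%R * sec p h.
Proof. by rewrite /extend Rpart_mul pbar_mul_sec. Qed.

Lemma extendM : {morph extend : x y / x * y}.
Proof.
move=> x y; rewrite -[in LHS](RpartK x) -[in LHS](RpartK y) mul_sec extend_mul_sec.
rewrite mul_sec !gmodHomD gmodHom_act.
congr (val _ * _); set h := pbar x; set k := pbar y.
(* The two R-parts agree exactly because [g] changes the cocycle by the coboundary of [b]. *)
have /(canRL (subrK _)) -> := gb h k.
rewrite gactD /coboundary1; move: (gact h (b k)) (gact h (g _)) => X G.
rewrite -[LHS]addrA (addrAC _ (ext_cocycle p h k)) (addrAC _ (b h)) subrK !addrA.
by rewrite (addrAC _ X) (addrAC _ G).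
Qed.

Lemma extend_Rbar (a : Rbar) : extend (val a) = val (g a).
Proof.
(* The section need not send 1 to 1, so elements of R/[R,R] are shifted by its value there. The
   resulting correction term is trivial, as the case [extend 1 = 1] shows. *)
have E c : extend (val (c + mkRbar (secK p 1))%R) = val (g c + b 1)%R * sec p 1.
  by rewrite val_RbarD /= extend_mul_sec.
have E1 : extend 1 = 1 by exact: (hom1 extendM).
have := E (- mkRbar (secK p 1))%R; rewrite addNr val_Rbar0 E1 => gb1.
have := E (a - mkRbar (secK p 1))%R; rewrite subrK => ->.
by rewrite gmodHomD -addrA val_RbarD -mulgA -gb1 mulg1.
Qed.

Lemma extend_surj y : exists x, extend x = y.
Proof.
have [g' _ g'K] := zhatGAut_bij g.
exists (val (g' (Rpart y - b (pbar y))%R) * sec p (pbar y)).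
by rewrite extend_mul_sec g'K subrK RpartK.
Qed.

Lemma extend_continuous : continuous extend.
Proof.
apply: morph_continuous; first exact: extendM.
move=> W W1.
have : nbhs (0%R : Rbar) (fun a => W (val (g a))).
  apply: (@zhatGAut_continuous _ _ g 0%R (val @^-1` W)).
  rewrite gmodHom0; exact: (@val_Rbar_continuous _ _ p 0%R).
move=> [O [[O' oO' O'O] O0] OW].
have oO : open_nbhs (1 : Fbar) (O' `&` @Rbar_set F H p).
  split; first by apply: openI => //; exact: Rbar_set_open.
  split; last by apply/Rbar_setP; exact: pbar1.
  by move: O0; rewrite -O'O.
apply: filterS (open_nbhs_nbhs oO) => x [O'x /Rbar_setP px] /=.
have -> : x = val (mkRbar px) by [].
by rewrite extend_Rbar; apply: OW; rewrite -O'O.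
Qed.
End Extension.
End Fbar.

(** * The profinite Gaschuetz lemma *)

Lemma gen_finite_surj (G K : topGroupType) (I : finType) (f : G -> K) (x : I -> G) :
  {morph f : a b / a * b} -> continuous f -> (forall b, exists a, f a = b) ->
  gen_finite x -> gen_finite (f \o x).
Proof.
move=> fM fC fS gx Q q qC b; have [a <-] := fS b.
exact: (gx _ _ (cont_hom_comp fM fC qC) a).
Qed.

Lemma mem_image_gen (G : topGroupType) (Q Q' : finGroupType) (I : finType)
  (q : G -> Q) (f : Q -> Q') (y : I -> G) u :
  {morph f : a b / a * b} -> u \in image_gen q y -> f u \in image_gen (f \o q) y.
Proof.
move=> fM; have gD : group_set [set u | f u \in image_gen (f \o q) y]%SET.
  apply/group_setP; split=> [|v w]; rewrite !finset.in_set.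
    by rewrite (hom1 fM) group1.
  by rewrite fM; exact: groupM.
have /fintype.subsetP sD : image_gen q y \subset group gD.
  rewrite gen_subG; apply/fintype.subsetP => _ /imsetP[i _ ->]; rewrite finset.in_set.
  by apply: mem_gen; exact: imset_f.
by move=> /sD; rewrite finset.in_set.
Qed.

Section ProfiniteGaschutz.
Variables (F : profiniteGroupType) (I : finType) (x z : I -> F) (K : normalSubgroup F).
Hypotheses (gx : gen_finite x) (gz : gen_finite (coset_map K \o z)).
Hypothesis cK : closed (nsub_set K).

(** The finite lemma is applied to the images [G] of F and [N] of [K] under [q], and to the tuple
    [q (z i)]. *)
Lemma finite_level_gaschutz (Q : finGroupType) (q : F -> Q) : cont_hom q ->
  exists k : I -> F, (forall i, nsub_set K (k i)) /\
    forall a, q a \in image_gen q (fun i => z i * k i).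
Proof.
move=> qC; have [qM _] := qC.
have sT : is_subgroup [set: F] by [].
have [G GP] := image_group qM sT.
have [N NP] := image_group qM (nsub_subgroup K).
have qG a : q a \in G by apply/GP; exists a.
have nNG : N <| G.
  apply/andP; split; first by apply/fintype.subsetP => _ /NP[k _ <-].
  apply/fintype.subsetP => _ /GP[g _ <-]; rewrite finset.in_set.
  apply/fintype.subsetP => _ /imsetP[_ /NP[k Kk <-] ->]; apply/NP.
  by exists (k ^ g); [exact: nsub_conj|rewrite !conjgE !qM (homV qM)].
have nG a : q a \in 'N(N) by apply: (fintype.subsetP (normal_norm nNG)).
(* The map from F/K to G/N induced by [q]. Its continuity transfers generation of F/K by [z] to
   generation of [G] modulo [N]. *)
pose r (u : quotg K) : coset_of N := coset N (q (generic_quotient.repr u)).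
have rE a : r (coset_map K a) = coset N (q a).
  rewrite /r; have Ka := repr_coset_map K a.
  rewrite -(mulKVg a (generic_quotient.repr (coset_map K a))) qM morphM ?nG //=.
  rewrite [X in _ * X]coset_id ?mulg1 //; apply/NP.
  by eexists; first exact: Ka.
have rC : cont_hom r.
  apply: cont_homP => [u v|].
    rewrite -[u]coset_map_repr -[v]coset_map_repr -coset_mapM !rE qM.
    by rewrite morphM ?nG.
  apply: filterS (coset_map_nbhs K (cont_hom_ker qC)).
  by move=> _ [a qa <-]; rewrite rE qa coset_id.
pose x' := [ffun i => q (x i)]; pose z' := [ffun i => q (z i)].
have tgE (y : I -> F) : tuple_gen [ffun i => q (y i)] = image_gen q y.
  by apply: val_inj; congr <<_>>; apply: eq_imset => i; rewrite ffunE.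
have xG : tuple_gen x' = G.
  rewrite tgE; apply/val_inj/eqP; rewrite finset.eqEsubset.
  rewrite gen_subG; apply/andP; split; apply/fintype.subsetP => u.
    by move=> /imsetP[i _ ->].
  by move=> /GP[a _ <-]; exact: gx.
have zG : gen_mod G N z'.
  have zsG : tuple_gen z' \subset G.
    by rewrite tuple_gen_sub; apply/forallP => i; rewrite ffunE.
  rewrite /gen_mod zsG /= -quotientSK ?normal_norm //.
  apply/fintype.subsetP => _ /morphimP[_ _ /GP[a _ <-] ->] /=.
  have := gz rC (coset_map K a); rewrite rE; apply: fintype.subsetP.
  rewrite gen_subG; apply/fintype.subsetP => _ /imsetP[i _ ->] /=.
  rewrite rE; apply/mem_quotient/mem_gen/imsetP.
  by exists i => //; rewrite ffunE.
have [t /forallP zt tG] := gaschutz nNG xG zG.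
have ex i : exists k, nsub_set K k /\ q (z i * k) = t i.
  have /NP[k Kk qk] := zt i; exists k; split=> //.
  by rewrite qM qk ffunE mulKVg.
pose k i := sval (cid (ex i)).
have [kK kt] : (forall i, nsub_set K (k i)) /\ (forall i, q (z i * k i) = t i).
  by split=> i; rewrite /k; case: cid => ? [].
exists k; split=> // a; rewrite -tgE.
rewrite (_ : [ffun _ => _] = t) ?tG //.
by apply/ffunP => i; rewrite ffunE.
Qed.

(** Correcting tuples [k] are sought in the compact space of I-indexed tuples in [K]. Those that
    work for a given finite quotient form a nonempty set, these sets are directed, and a cluster
    point works for all quotients. *)
Lemma profinite_gaschutz :
  exists2 y : I -> F, gen_finite y & forall i, coset_map K (y i) = coset_map K (z i).
Proof.
pose P := prod_topology (fun _ : I => F : topologicalType).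
pose A : set P := [set k | forall i, nsub_set K (k i)].
have cA : compact A.
  apply: (@tychonoff I (fun _ => F) (fun _ => nsub_set K)) => _.
  exact: subclosed_compact cK (@profinite_compact F) _.
pose D (Q : finGroupType) (q : F -> Q) : set P :=
  [set k | A k /\ forall a, q a \in image_gen q (fun i => z i * k i)].
pose S : set_system P :=
  [set B | exists (Q : finGroupType) (q : F -> Q), cont_hom q /\ D Q q `<=` B].
have PS : ProperFilter S.
  apply: Build_ProperFilter_ex.
    move=> B [Q [q [qC DB]]]; have [k [kK kq]] := finite_level_gaschutz qC.
    by exists k; apply: DB.
  split.
  (* Only the trivial homomorphism matters here; [{perm bool}] is an arbitrary finite group. *)
  - exists {perm bool}, (fun _ => 1); split=> //.
    by apply: cont_homP => [a b|]; [rewrite mulg1|exact: nearW].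
  - move=> B B' [Q [q [qC DB]]] [Q' [q' [q'C DB']]].
    (* Generation in the image of the product map implies generation under both projections. *)
    exists (Q * Q')%type, (fun a => (q a, q' a)); split; first exact: cont_hom_pair.
    move=> k [Ak kq]; split; [apply: DB|apply: DB']; split=> // a.
      exact: (@mem_image_gen _ _ _ _ _ fst _ _ (fun _ _ => erefl) (kq a)).
    exact: (@mem_image_gen _ _ _ _ _ snd _ _ (fun _ _ => erefl) (kq a)).
  - by move=> B B' BB' [Q [q [qC DB]]]; exists Q, q; split=> // k /DB/BB'.
have [k [Ak kS]] : A `&` cluster S !=set0.
  apply: cA; exists {perm bool}, (fun _ => 1); split; last by move=> k [].
  by apply: cont_homP => [a b|]; [rewrite mulg1|exact: nearW].
exists (fun i => z i * k i); last first.
  move=> i; apply/coset_mapP; have [_ _ NV] := nsub_subgroup K.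
  by rewrite invgM mulgVK; exact: NV.
move=> Q q qC a.
have SD : S (D Q q) by exists Q, q; split.
(* Whether a tuple works for [q] depends only on its image under [q], which is constant near [k];
   hence the cluster point inherits the property from nearby tuples. *)
have nk : nbhs k [set k' : P | forall i, q (k' i) = q (k i)].
  have nki i : nbhs k [set k' : P | q (k' i) = q (k i)]; last first.
    apply: (@filter_forall P I (fun i k' => q (k' i) = q (k i)) (nbhs k) _ nki).
  have := @proj_continuous I (fun _ => F) i k.
  have [_ qc] := qC.
  move=> /(_ [set b | q b = q (k i)]); apply.
  by have := qc (k i) _ (@discrete_set1 (discrete_topology Q) (q (k i))).
have [k' [[_ k'q] kk']] := kS _ _ SD nk.
have := k'q a; rewrite (_ : image_gen _ _ = image_gen q (fun i => z i * k i)) //.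
apply: val_inj; congr <<_>>; apply: eq_imset => i /=.
by have [qM _] := qC; rewrite !qM kk'.
Qed.
End ProfiniteGaschutz.

(** * Image of rho *)

Lemma compact_hausdorff_inv_continuous (T U : topologicalType) (f : T -> U) (g : U -> T) :
  compact [set: T] -> hausdorff_space U -> continuous f ->
  cancel f g -> cancel g f -> continuous g.
Proof.
move=> cT hU fC fg gf; apply/continuous_closedP => A cA.
rewrite (_ : g @^-1` A = f @` A); last first.
  by apply/seteqP; split=> [u Au|_ [t At <-]]; [exists (g u)|rewrite /= fg].
apply: compact_closed => //; apply: continuous_compact.
  exact: continuous_subspaceT.
exact: subclosed_compact cA cT _.
Qed.

Lemma closed_equalizer (T U : topologicalType) (f g : T -> U) :
  hausdorff_space U -> continuous f -> continuous g -> closed [set t | f t = g t].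
Proof.
move=> hU fC gC t ct; apply: hU => A B /fC fA /gC gB.
have [s [/= fgs [As Bs]]] :=
  ct (f @^-1` A `&` g @^-1` B) (filterI (fA : nbhs t _) (gB : nbhs t _)).
by exists (f s); split=> //; rewrite fgs.
Qed.

(* If the approximations of z a diverge, [lim] is the junk value [point], which u fixes. *)
Lemma zhat_scale_homeo (G : groupType) (A : topGModType G) (u v : A -> A) (z : zhat) a :
  hausdorff_space A -> {morph u : a b / (a + b)%R} ->
  u point = point ->
  continuous u -> continuous v -> cancel u v -> cancel v u ->
  u (zhat_scale z a) = zhat_scale z (u a).
Proof.
move=> hA uD u0 uC vC uv vu.
have uz : u 0%R = 0%R by apply: (addrI (u 0%R)); rewrite -uD !addr0.
have uMn n b : u (b *+ n)%R = (u b *+ n)%R.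
  by elim: n => [|n IHn]; rewrite ?mulr0n // !mulrS uD IHn.
rewrite /zhat_scale.
set s : nat -> A := (fun n => a *+ _)%R.
rewrite (_ : (fun n => u a *+ _)%R = u \o s); last first.
  by apply/funext => n; rewrite /= uMn.
have [[l sl]|ns] := pselect (exists l : A, s @ \oo --> l).
  have -> : lim (s @ \oo) = l by exact: cvg_lim.
  have usl : (u \o s) @ \oo --> u l by apply: (@cvg_comp _ _ _ s u \oo _ _ sl (uC l)).
  by apply/esym; exact: cvg_lim.
have -> : lim (s @ \oo) = point.
  rewrite /lim; apply: xgetPN => l sl; apply: ns; exists l; exact: sl.
have -> : lim ((u \o s) @ \oo) = point; last by [].
rewrite /lim; apply: xgetPN => l usl; apply: ns; exists (v l).
have -> : s = v \o (u \o s) by apply/funext => n /=; rewrite uv.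
exact: (@cvg_comp _ _ _ (u \o s) v \oo _ _ usl (vC l)).
Qed.

(** * Automorphisms over H induce module automorphisms that fix the extension class *)

Section Forward.
Variables (F : profiniteGroupType) (H : finGroupType) (p : contEpi F H).
Local Notation Fbar := (Fbar p).
Local Notation Rbar := (Rbar p).
Implicit Types a : A_pi p.

Lemma toFbarM : {morph @toFbar F H p : u v / u * v}.
Proof. exact: coset_mapM. Qed.

Lemma toFbar_surj (u : Fbar) : exists w, toFbar p w = u.
Proof. by exists (generic_quotient.repr u); exact: coset_map_repr. Qed.

Lemma Fbar_autM a : {morph Fbar_aut a : u v / u * v}.
Proof.
move=> u v; have [u' <-] := toFbar_surj u; have [v' <-] := toFbar_surj v.
by rewrite -toFbarM !Fbar_autE autFM toFbarM.
Qed.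

Lemma pbar_Fbar_aut a u : pbar (Fbar_aut a u) = pbar u.
Proof. by have [u' <-] := toFbar_surj u; rewrite Fbar_autE !pbarE A_piE. Qed.

Lemma Fbar_aut_continuous a : continuous (Fbar_aut a).
Proof.
apply/quotient_continuous.
rewrite (_ : _ \o _ = @toFbar F H p \o val a); last first.
  by apply/funext => w; exact: Fbar_autE.
move=> w; apply: continuous_comp; first exact: autF_continuous.
exact: coset_map_continuous.
Qed.

Lemma rho_continuous a : continuous (rho a).
Proof.
apply: (@continuous_comp_initial _ _ _ set_val) => y.
apply: (@continuous_comp _ _ _ (val : Rbar -> Fbar) (Fbar_aut a)).
  exact: val_Rbar_continuous.
exact: Fbar_aut_continuous.
Qed.

(** The inverse of [a] is continuous since F is compact and Hausdorff, and it also lies over H. *)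
Lemma A_pi_inv a : exists a', cancel (rho a) (rho a') /\ cancel (rho a') (rho a).
Proof.
have [f aK fK] := autF_bij (val a).
have fM : {morph f : u v / u * v}.
  by move=> u v; apply: (can_inj aK); rewrite autFM !fK.
have fC : continuous f.
  apply: (compact_hausdorff_inv_continuous _ _ _ aK fK).
  - exact: profinite_compact.
  - exact: profinite_hausdorff.
  - exact: autF_continuous.
have fB : bijective f by exists (val a).
have fp : (AutF fM fB fC) \in A_pi p.
  by apply/mem_set/funext => w; rewrite /= -{2}(fK w) A_piE.
exists (exist (fun a : autF F => a \in A_pi p) _ fp); split=> y; apply: val_inj => /=;
  have [w <-] := toFbar_surj (val y); by rewrite !Fbar_autE /= ?aK ?fK.
Qed.

Lemma rho_hom a : exists u : gmodHom Rbar Rbar, u = rho a :> (_ -> _).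
Proof.
have rD : {morph rho a : y z / (y + z)%R}.
  by move=> y z; apply: val_inj; exact: Fbar_autM.
have rA h y : rho a (gact h y) = gact h (rho a y).
  apply: val_inj; rewrite -(secK p h); set s := sec p h.
  have valE : val (rho a y) = Fbar_aut a (val y) by [].
  transitivity (Fbar_aut a (s * val y * s^-1)).
    by rewrite -(val_Rbar_act s y).
  (* The image of [s] under [a] is another lift of the same element of H, and the action may be
     computed with any lift. *)
  rewrite -[in RHS](pbar_Fbar_aut a s) !Fbar_autM (homV (@Fbar_autM a)) -valE.
  exact/esym/val_Rbar_act.
by exists (GModHom rD rA).
Qed.

Lemma rho_Aut_fixing a : Aut_fixing (ext_class p) (rho a).
Proof.
have [u uE] := rho_hom a; have [a' [aa' a'a]] := A_pi_inv a.
have p0 (b : A_pi p) : rho b point = point.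
  by have [w wE] := rho_hom b; rewrite -wE; exact: (gmodHom0 w).
have uS z y : u (zhat_scale z y) = zhat_scale z (u y).
  rewrite uE; apply: (@zhat_scale_homeo _ _ (rho a) (rho a')) => //.
  - exact: Rbar_hausdorff.
  - by move=> b c; rewrite -uE gmodHomD.
  - exact: rho_continuous.
  - exact: rho_continuous.
have uB : bijective u by rewrite uE; exists (rho a').
have uC : continuous u by rewrite uE; exact: rho_continuous.
exists (ZhatGAut uS uB uC); split; first by rewrite /= uE.
rewrite /ext_class H2_mapE /=.
(* The section moved by [a] has as its cocycle the image of the extension cocycle under [rho a]. *)
apply/esym/(@ext_class_section _ _ _ (Fbar_aut a \o @sec _ _ p)).
  by move=> h; rewrite /= pbar_Fbar_aut secK.
move=> g h; rewrite /= uE /=.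
by rewrite !Fbar_autM (homV (@Fbar_autM a)).
Qed.
End Forward.

(** * Module automorphisms that fix the extension class come from automorphisms of F over H *)

Section Backward.
Variables (d : nat) (F : profiniteGroupType) (x : 'I_d -> F).
Hypothesis hF : free_profinite x.
Variables (H : finGroupType) (p : contEpi F H).
Local Notation Fbar := (Fbar p).
Local Notation Rbar := (Rbar p).

(** Representatives [z] of the images of the free generators generate F modulo [R,R] because [f] is
    onto. They are corrected within [R,R], which is closed, to a tuple [y] that generates F. *)
Lemma Fbar_lift (f : Fbar -> Fbar) : {morph f : u v / u * v} -> continuous f ->
  (forall v, exists u, f u = v) ->
  exists a : autF F, forall w, toFbar p (a w) = f (toFbar p w).
Proof.
move=> fM fC fS; pose K := closed_commutator (kerR p).
pose z i := generic_quotient.repr (f (toFbar p (x i))).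
have gx := free_gen_finite hF.
have zE i : toFbar p (z i) = f (toFbar p (x i)) by exact: coset_map_repr.
have tC : continuous (@toFbar F H p) by exact: coset_map_continuous.
have gz : gen_finite (coset_map K \o z).
  rewrite (_ : _ \o z = (f \o @toFbar F H p) \o x); last exact/funext.
  apply: gen_finite_surj => // [u v|w|v] /=.
  - by rewrite toFbarM fM.
  - by apply: continuous_comp; [exact: tC|exact: fC].
  - by have [u <-] := fS v; have [w <-] := toFbar_surj u; exists w.
have [y gy yz] := profinite_gaschutz gx gz (@closed_closure _ _).
(* The universal property with target F itself gives the endomorphism sending [x] to [y];
   [free_hopfian] makes it bijective. *)
have [al [[aM aC ax] _]] := hF y.
have aB := free_hopfian hF gy aM aC ax.
exists (AutF aM aB aC) => /= w.
(* The elements on which [al] lifts [f] form a closed subgroup containing the generators [x]. *)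
apply: (closed_subgroup_gen (S := [set w | toFbar p (al w) = f (toFbar p w)]) gx).
- apply: closed_equalizer (@Fbar_hausdorff _ _ p) _ _ => v.
    by apply: continuous_comp; [exact: aC|exact: tC].
  by apply: continuous_comp; [exact: tC|exact: fC].
- split=> /= [|u v uE vE|u uE].
  + rewrite (hom1 aM); have t1 := hom1 (@toFbarM F H p); rewrite t1; exact/esym/(hom1 fM).
  + by rewrite aM !toFbarM uE vE fM.
  + by rewrite (homV aM) !(homV (@toFbarM F H p)) uE (homV fM).
- by move=> i /=; rewrite ax -zE; exact: yz.
Qed.

Lemma Aut_fixing_rho (u : Rbar -> Rbar) :
  Aut_fixing (ext_class p) u -> exists a, rho a = u.
Proof.
move=> [g [-> gE]].
have [b bE] : exists b : H -> Rbar, forall h k,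
  (g (ext_cocycle p h k) - ext_cocycle p h k = coboundary1 b h k)%R.
  (* Equality of the two classes means that the cocycles differ by a coboundary, whose cochain is
     [b]. *)
  move: gE; rewrite /ext_class H2_mapE => /eqP.
  rewrite -Quotient.idealrBE => /asboolP[b bE]; exists b => h k.
  by rewrite -bE.
have [al alE] := Fbar_lift (extendM bE) (extend_continuous bE) (extend_surj g b).
have ap : al \in A_pi p.
  by apply/mem_set/funext => w; rewrite /= -[in LHS]pbarE alE pbar_extend pbarE.
exists (exist (fun a : autF F => a \in A_pi p) _ ap).
apply/funext => y; apply: val_inj => /=.
have [w wE] := toFbar_surj (val y).
by rewrite -wE Fbar_autE alE wE (extend_Rbar bE).
Qed.
End Backward.

Theorem theorem1p3 (d : nat) (hd : (1 <= d)%N)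
    (F : profiniteGroupType) (x : 'I_d -> F) (hF : free_profinite x)
    (H : finGroupType) (p : contEpi F H) :
  range (@rho F H p) = Aut_fixing (ext_class p).
Proof.
apply/seteqP; split=> [_ [a _ <-]|u /(Aut_fixing_rho hF)[a <-]].
  exact: rho_Aut_fixing.
by exists a.
Qed.
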